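(* Let $0\le\gamma\le\pi/2$, let $\Omega=|\Omega\rangle\langle\Omega|$ be the density operator of the two-qubit pure state $$|\Omega\rangle=\cos\left(\tfrac{\pi}{4}-\tfrac{\gamma}{2}\right)|\uparrow\uparrow\rangle+\sin\left(\tfrac{\pi}{4}-\tfrac{\gamma}{2}\right)|\downarrow\downarrow\rangle ,$$ and let $\mathcal{T}(\Omega)$ be the Werner state produced from $\Omega$ by $U\otimes U^*$ twirling. Then the entanglement of the two states is the same, while the geometric discord is increased: $$E[\mathcal{T}(\Omega)]=E[\Omega]\qquad\text{and}\qquad \mathcal{D}_{\mathrm g}(\mathcal{T}(\Omega))\ge\mathcal{D}_{\mathrm g}(\Omega),$$ where $E$ is the entanglement of formation and $\mathcal{D}_{\mathrm g}$ is the geometric discord.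
   Context: $|\uparrow\rangle,|\downarrow\rangle$ is a fixed orthonormal basis of $\mathbb{C}^2$ and $\mathbb{I}$ is the $2\times2$ identity. A two-qubit state is a positive semidefinite, trace-one operator on $\mathbb{C}^2\otimes\mathbb{C}^2$. Twirling. $\mathcal{T}(\rho)=\int_{SU(2)}(U\otimes U^* )\,\rho\,(U\otimes U^* )^\dagger\,dU$, where $dU$ is normalized Haar measure and $U^*$ is the entrywise complex conjugate of $U$ in the basis $|\uparrow\rangle,|\downarrow\rangle$. The result is a Werner state, i.e. a state $F\,\Phi^++\frac{1-F}{3}(\Phi^-+\Psi^++\Psi^-)$ with $0\le F\le1$, where $\Phi^\pm,\Psi^\pm$ are the rank-one projections onto $|\Phi^\pm\rangle=(|\uparrow\uparrow\rangle\pm|\downarrow\downarrow\rangle)/\sqrt2$ and $|\Psi^\pm\rangle=(|\uparrow\downarrow\rangle\pm|\downarrow\uparrow\rangle)/\sqrt2$. Entanglement. The entanglement of formation of a two-qubit state $\rho$ is given by $E[\rho]=H_2\Big(\frac{1+\sqrt{1-\mathcal{C}^2(\rho)}}{2}\Big)$, where $H_2(x)=-x\log_2x-(1-x)\log_2(1-x)$ (with $0\log_2 0=0$) and $\mathcal{C}(\rho)$ is the (Wootters) concurrence: $\mathcal{C}(\rho)=\max(0,\lambda_1-\lambda_2-\lambda_3-\lambda_4)$, where $\lambda_1\ge\lambda_2\ge\lambda_3\ge\lambda_4\ge0$ are the square roots of the eigenvalues of $\rho(\sigma_2\otimes\sigma_2)\rho^*(\sigma_2\otimes\sigma_2)$,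 $\rho^*$ is the entrywise complex conjugate of $\rho$ in the product basis, and $\sigma_2=-i|\uparrow\rangle\langle\downarrow|+i|\downarrow\rangle\langle\uparrow|$. Geometric discord. For a projective measurement $\Pi^a=\{\Pi^a_1,\Pi^a_2\}$ on the first qubit (rank-one orthogonal projections on $\mathbb{C}^2$ with $\Pi^a_1+\Pi^a_2=\mathbb{I}$), put $\chi_\rho=\sum_i(\Pi^a_i\otimes\mathbb{I})\rho(\Pi^a_i\otimes\mathbb{I})$. With $\|A\|^2=\mathrm{Tr}(AA^\dagger)$, $\mathcal{D}_{\mathrm g}(\rho)=\min_{\Pi^a}\|\rho-\chi_\rho\|^2$. *)

(* Defs.v *)
From HB Require Import structures.
From mathcomp Require Import all_boot all_order all_algebra spectral.
From mathcomp Require Import all_classical all_reals all_analysis.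
From mathcomp.real_closed Require Import complex mxtens.

Set Implicit Arguments.
Unset Strict Implicit.
Unset Printing Implicit Defensive.

Import Order.TTheory GRing.Theory Num.Theory.
Import numFieldNormedType.Exports.

Local Open Scope classical_set_scope.
Local Open Scope complex_scope.
Local Open Scope ring_scope.

(* The usual topology of the complex numbers, which makes ['M[R[i]]_(m, n)] a
   topological space. *)
HB.instance Definition _ (R : rcfType) := NormedModule.copy R[i] R[i]^o.

Section Matrices.
Variable R : rcfType.

Definition conjmx_entry m n (A : 'M[R[i]]_(m, n)) : 'M[R[i]]_(m, n) :=
  map_mx Num.conj A.

Definition adjmx m n (A : 'M[R[i]]_(m, n)) : 'M[R[i]]_(n, m) :=
  conjmx_entry A^T.

Definition hs_normsq n (A : 'M[R[i]]_n) : R := complex.Re (\tr (A *m adjmx A)).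

(* Eigenvalues listed with algebraic multiplicity, in no particular order. *)
Definition eigenvalues n (A : 'M[R[i]]_n) : seq R[i] :=
  sval (closed_field_poly_normal (char_poly A)).

End Matrices.

Section TwoQubits.
Variable R : realType.

(* [ket_up] and [ket_down] are the fixed orthonormal basis of C^2. Two-qubit
   operators are ['M_(2 * 2)], with the product basis ordered by the Kronecker
   product [*t]. *)
Definition ket_up : 'cV[R[i]]_2 := delta_mx 0 0.
Definition ket_down : 'cV[R[i]]_2 := delta_mx 1 0.

Definition proj_on n (v : 'cV[R[i]]_n) : 'M[R[i]]_n := v *m adjmx v.

Definition ket_Omega (gamma : R) : 'cV[R[i]]_(2 * 2) :=
  (cos (pi / 4 - gamma / 2))%:C *: (ket_up *t ket_up)
  + (sin (pi / 4 - gamma / 2))%:C *: (ket_down *t ket_down).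

Definition Omega (gamma : R) : 'M[R[i]]_(2 * 2) := proj_on (ket_Omega gamma).

Definition sigma2 : 'M[R[i]]_2 :=
  (- 'i%C) *: (ket_up *m adjmx ket_down) + 'i%C *: (ket_down *m adjmx ket_up).

(* For a state [rho] the eigenvalues below are nonnegative reals, so that taking
   their real parts loses nothing. *)
Definition wootters_spectrum (rho : 'M[R[i]]_(2 * 2)) : seq R :=
  let S := sigma2 *t sigma2 in
  sort >=%R [seq Num.sqrt (complex.Re z)
            | z <- eigenvalues (rho *m S *m conjmx_entry rho *m S)].

Definition concurrence (rho : 'M[R[i]]_(2 * 2)) : R :=
  let l := wootters_spectrum rho in
  Num.max 0 (l`_0 - l`_1 - l`_2 - l`_3).

Definition log2 (x : R) : R := ln x / ln 2.

Definition H2 (x : R) : R := - x * log2 x - (1 - x) * log2 (1 - x).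

Definition entanglement_of_formation (rho : 'M[R[i]]_(2 * 2)) : R :=
  H2 ((1 + Num.sqrt (1 - concurrence rho ^+ 2)) / 2).

Definition rank_one_projection (P : 'M[R[i]]_2) : Prop :=
  [/\ P *m P = P, adjmx P = P & \rank P = 1%N].

Definition projective_measurement (P : 'I_2 -> 'M[R[i]]_2) : Prop :=
  (forall i, rank_one_projection (P i)) /\ \sum_i P i = 1%:M.

Definition post_measurement (P : 'I_2 -> 'M[R[i]]_2) (rho : 'M[R[i]]_(2 * 2)) :
    'M[R[i]]_(2 * 2) :=
  \sum_i (P i *t 1%:M) *m rho *m (P i *t 1%:M).

(* The infimum is a minimum: the projective measurements form a compact set, on
   which the distance is continuous. *)
Definition geometric_discord (rho : 'M[R[i]]_(2 * 2)) : R :=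
  inf [set hs_normsq (rho - post_measurement P rho)
      | P in projective_measurement].

End TwoQubits.

Section Twirling.
Variable R : realType.

Definition SU2 : set 'M[R[i]]_2 := [set U | U \is unitarymx /\ \det U = 1].

Lemma SU2_1 : SU2 1%:M.
Proof.
split; last exact: det1.
by apply/unitarymxP; rewrite trmx1 map_mx1 mulmx1.
Qed.

Lemma SU2_mul U V : SU2 U -> SU2 V -> SU2 (U *m V).
Proof.
move=> [uU dU] [uV dV]; split; first exact: mul_unitarymx.
by rewrite det_mulmx dU dV mulr1.
Qed.

HB.instance Definition _ := isPointed.Build SU2 (SigSub (mem_set SU2_1)).

Definition SU2_mulg (U V : SU2) : SU2 :=
  SigSub (mem_set (SU2_mul (set_valP U) (set_valP V))).

(* SU(2) with its Borel sigma-algebra, for the topology induced by the one of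
   the 2 x 2 complex matrices. *)
Definition SU2_borel := g_sigma_algebraType (@open SU2).

(* On a compact group, a left-invariant Borel probability measure is the (unique,
   bi-invariant) normalized Haar measure. *)
Definition normalized_haar (mu : probability SU2_borel R) : Prop :=
  forall (V : SU2) (A : set SU2_borel), measurable A ->
    mu (SU2_mulg V @` A) = mu A.

Definition twirl_conj (U : 'M[R[i]]_2) (rho : 'M[R[i]]_(2 * 2)) :
    'M[R[i]]_(2 * 2) :=
  (U *t conjmx_entry U) *m rho *m adjmx (U *t conjmx_entry U).

Definition twirl (mu : probability SU2_borel R) (rho : 'M[R[i]]_(2 * 2)) :
    'M[R[i]]_(2 * 2) :=
  \matrix_(i, j)
    (Rintegral mu setT (fun U : SU2 => complex.Re (twirl_conj (\val U) rho i j))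
     +i* Rintegral mu setT (fun U : SU2 => complex.Im (twirl_conj (\val U) rho i j))).

End Twirling.

(* Main.v *)
(* The vector [|Omega>] is the vectorization of [D = diag(c, s)], where [c] and
   [s] are its coefficients, and [U (x) U^*] maps [vec K] to [vec (U K U^dag)].
   As [D = p + q sigma_3] with [p = (c + s)/2] and [q = (c - s)/2], the rotated
   vector is [vec (p + q n.sigma)] for the unit Bloch vector [n = n(U)].
   Invariance of the Haar measure under two elements of SU(2), a half turn and
   a cyclic permutation of the axes, gives [E n_k = 0] and
   [E (n_j n_k) = delta_jk / 3]. Since
   [\sum_a |vec sigma_a><vec sigma_a| = 2], with [sigma_0 = 1] included, the
   twirled state is [2 w + (p^2 - w) |vec 1><vec 1|] with [w = q^2 / 3].

   For both states [rho (sigma_2 (x) sigma_2) rho^* (sigma_2 (x) sigma_2)] is a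
   scalar matrix plus a rank one matrix, and both concurrences are [2 c s].

   If [K = a P_0 + b P_1] for a projective measurement [P], then measuring
   [z + y |vec K><vec K|] moves it by [sqrt 2 * y a b] in Hilbert-Schmidt norm.
   For the twirled state ([K = 1]) this holds for every [P]; for [Omega] take
   the measurement in the standard basis. The inequality then reads
   [c s <= (1 + 4 c s) / 6], i.e. [2 c s <= 1]. *)

Require Import Defs.
From HB Require Import structures.
From mathcomp Require Import all_boot all_order all_algebra spectral.
From mathcomp Require Import all_classical all_reals all_analysis.
From mathcomp.real_closed Require Import complex mxtens.
From mathcomp Require Import measurable_realfun ring lra.

Set Implicit Arguments.
Unset Strict Implicit.
Unset Printing Implicit Defensive.

Import Order.TTheory GRing.Theory Num.Theory.
Import numFieldNormedType.Exports.

Local Open Scope classical_set_scope.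
Local Open Scope complex_scope.
Local Open Scope ring_scope.

(** * Vectorization and rank one perturbations *)

Section MatrixAlgebra.

(** In the rank factorization of [P] as column base times row base, idempotence forces the product
    in the opposite order to be the identity of size [\rank P]; the trace does not see the order. *)
Lemma mxtrace_idempotent (F : fieldType) n (P : 'M[F]_n) :
  P *m P = P -> \tr P = (\rank P)%:R.
Proof.
move=> PP; rewrite -[in LHS](mulmx_base P) mxtrace_mulC.
suff -> : row_base P *m col_base P = 1%:M by rewrite mxtrace1.
apply: (row_free_inj (row_base_free P)); apply: (row_full_inj (col_base_full P)).
by rewrite /= mul1mx -mulmxA mulmxA mulmx_base PP.
Qed.

(* Both sides, times [x], are the determinant of [block_mx x%:M u w 1] multiplied
   on the left by a block triangular matrix. *)
Lemma det_scalar_sub_rank1 (D : idomainType) n (x : D) (u : 'cV[D]_n.+1)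
    (w : 'rV[D]_n.+1) :
  x != 0 -> \det (x%:M - u *m w) = x ^+ n * (x - (w *m u) 0 0).
Proof.
move=> x0; apply: (mulfI x0); rewrite mulrA -exprS.
pose M := block_mx x%:M u w (1%:M : 'M[D]_1).
have detM : \det M = \det (x%:M - u *m w).
  have : \det (block_mx 1%:M (- u) 0 1%:M *m M) = \det (x%:M - u *m w).
    rewrite mulmx_block !mul1mx !mulmx1 mul0mx mulNmx add0r subrr mul0mx add0r.
    by rewrite det_lblock det1 mulr1.
  by rewrite det_mulmx det_ublock !det1 !mul1r.
have : \det (block_mx 1%:M 0 (- w) x%:M *m M) = x ^+ n.+1 * (x - (w *m u) 0 0).
  rewrite mulmx_block !mul1mx !mul0mx !addr0 !mulNmx mul_mx_scalar mul_scalar_mx.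
  rewrite addNr mulmx1 det_ublock det_scalar; congr (_ * _).
  by rewrite det_mx11 !mxE addrC mulr1n.
by rewrite det_mulmx det_lblock det1 mul1r det_scalar1 detM.
Qed.

(** The determinant formula above, over polynomials, at ['X - a%:P]. It gives the Wootters spectra
    without diagonalizing anything. *)
Lemma char_poly_scalar_add_rank1 (D : idomainType) n (a : D) (u : 'cV[D]_n.+1)
    (w : 'rV[D]_n.+1) :
  char_poly (a%:M + u *m w)
    = ('X - a%:P) ^+ n * ('X - (a + (w *m u) 0 0)%:P).
Proof.
rewrite /char_poly /char_poly_mx map_mxD map_mxM map_scalar_mx opprD addrA.
rewrite -raddfB det_scalar_sub_rank1 ?polyXsubC_eq0 //.
congr (_ * _); rewrite polyCD opprD addrA; congr (_ - _).
by rewrite -map_mxM mxE.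
Qed.

(** Row-major vectorization, in the index order of the Kronecker product. *)
Definition vecmx (R : Type) m n (K : 'M[R]_(m, n)) : 'cV[R]_(m * n) :=
  \col_i K (mxtens_unindex i).1 (mxtens_unindex i).2.

Lemma sum_mxtens_index (V : nmodType) m n (F : 'I_(m * n) -> V) :
  \sum_i F i = \sum_i \sum_j F (mxtens_index (i, j)).
Proof.
rewrite pair_big /= (reindex (@mxtens_index m n)) /=.
  by apply: eq_bigr => -[].
by exists (@mxtens_unindex m n) => i _; rewrite (mxtens_indexK, mxtens_unindexK).
Qed.

Lemma tensmxDl (R : pzRingType) m n p q (A B : 'M[R]_(m, n)) (K : 'M[R]_(p, q)) :
  (A + B) *t K = A *t K + B *t K.
Proof. by apply/matrixP => i j; rewrite !mxE mulrDl. Qed.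

Lemma tensmx11 (R : pzRingType) m n :
  1%:M *t 1%:M = 1%:M :> 'M[R]_(m * n).
Proof.
apply/matrixP => i j.
case: (mxtens_indexP i) => i1 i2; case: (mxtens_indexP j) => j1 j2.
rewrite tensmxE !mxE (can_eq (@mxtens_indexK _ _)) xpair_eqE.
by case: eqP; case: eqP; rewrite /= ?mulr1 ?mulr0.
Qed.

Lemma mul_tensmx_vecmx (R : comPzRingType) m n p q (A : 'M[R]_(m, n))
    (B : 'M[R]_(p, q)) (K : 'M[R]_(n, q)) :
  (A *t B) *m vecmx K = vecmx (A *m K *m B^T).
Proof.
apply/matrixP => i j; case: (mxtens_indexP i) => i1 i2.
rewrite !mxE sum_mxtens_index mxtens_indexK /= exchange_big; apply: eq_bigr => l _.
rewrite !mxE mulr_suml; apply: eq_bigr => k _.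
by rewrite tensmxE !mxE mxtens_indexK /= mulrAC.
Qed.

Lemma ord2P (i : 'I_2) : i = 0 \/ i = 1.
Proof. by case: i => [[|[|//]] ?]; [left|right]; apply: val_inj. Qed.

Lemma ord3P (i : 'I_3) : i = 0 \/ i = 1 \/ i = 2.
Proof.
by case: i => [[|[|[|//]]] ?]; [left|right; left|right; right]; apply: val_inj.
Qed.

Lemma sum_ord2 (V : nmodType) (F : 'I_2 -> V) : \sum_i F i = F 0 + F 1.
Proof. by rewrite !big_ord_recl big_ord0 addr0; congr (_ + F _); apply: val_inj. Qed.

Lemma sum_ord3 (V : nmodType) (F : 'I_3 -> V) : \sum_i F i = F 0 + F 1 + F 2.
Proof.
by rewrite !big_ord_recl big_ord0 addr0 addrA; congr (F _ + F _ + F _); apply: val_inj.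
Qed.

Lemma mx2P (T : Type) (A B : 'M[T]_2) :
  A 0 0 = B 0 0 -> A 0 1 = B 0 1 -> A 1 0 = B 1 0 -> A 1 1 = B 1 1 -> A = B.
Proof.
move=> e00 e01 e10 e11; apply/matrixP.
by move=> i j; case: (ord2P i) => ->; case: (ord2P j) => ->.
Qed.

Lemma mulmx2E (D : pzSemiRingType) m n (A : 'M[D]_(m, 2)) (B : 'M[D]_(2, n)) i j :
  (A *m B) i j = A i 0 * B 0 j + A i 1 * B 1 j.
Proof. by rewrite mxE sum_ord2. Qed.

Lemma mxtrace2E (D : pzSemiRingType) (A : 'M[D]_2) : \tr A = A 0 0 + A 1 1.
Proof. exact: sum_ord2. Qed.

(** Stated with an abstract square root [I] of -1, so that each entry is a [ring] identity modulo
    [II]. *)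
Lemma conj_diag_antidiag (D : comPzRingType) (I a b : D) (Y : 'M[D]_2) :
  I * I = -1 -> Y = - I *: delta_mx 0 1 + I *: delta_mx 1 0 ->
  Y *m (a *: delta_mx 0 0 + b *: delta_mx 1 1) *m Y^T
    = - (b *: delta_mx 0 0 + a *: delta_mx 1 1).
Proof.
by move=> II ->; apply: mx2P; rewrite !mulmx2E !mxE /=; ring: II.
Qed.

Lemma tr_mul_diag (D : comPzRingType) (a b a' b' : D) :
  let diag x y : 'M[D]_2 := x *: delta_mx 0 0 + y *: delta_mx 1 1 in
  \tr (diag a b *m diag a' b') = a * a' + b * b'.
Proof. by rewrite /= mxtrace2E !mulmx2E !mxE /=; ring. Qed.

(** Idempotents summing to 1 leave scalar matrices unchanged, so the term [z] cancels. *)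
Lemma sub_pinching (D : comPzRingType) n (A : 'I_2 -> 'M[D]_n) (z y : D) (X : 'M[D]_n) :
  (forall i, A i *m A i = A i) -> \sum_i A i = 1%:M ->
  z%:M + y *: X - \sum_i A i *m (z%:M + y *: X) *m A i
    = y *: (X - \sum_i A i *m X *m A i).
Proof.
move=> AA A1.
under eq_bigr do
  rewrite mulmxDr mulmxDl mul_mx_scalar -scalemxAl AA -scalemxAr -scalemxAl.
rewrite big_split /= -!scaler_sumr A1 scalemx1 opprD addrACA subrr add0r.
by rewrite scalerBr.
Qed.

Lemma sub_pinching_rank1 (D : comPzRingType) n (a b : D) (v0 v1 : 'cV[D]_n)
    (w0 w1 : 'rV[D]_n) :
  (a *: v0 + b *: v1) *m (a *: w0 + b *: w1)
    - ((a *: v0) *m (a *: w0) + (b *: v1) *m (b *: w1))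
  = (a * b) *: (v0 *m w1 + v1 *m w0).
Proof.
rewrite mulmxDl !mulmxDr opprD addrACA.
rewrite [X in X + _]addrAC subrr add0r addrK -!scalemxAl -!scalemxAr !scalerA.
by rewrite scalerDr [b * a]mulrC.
Qed.

(** The operator exchanges [v0] and [v1]; its square is [v0 *m w0 + v1 *m w1], a sum of two terms of
    trace 1. *)
Lemma mxtrace_cross_sqr (D : comPzRingType) n (v0 v1 : 'cV[D]_n) (w0 w1 : 'rV[D]_n) :
  w0 *m v0 = 1%:M -> w1 *m v1 = 1%:M -> w0 *m v1 = 0 -> w1 *m v0 = 0 ->
  \tr ((v0 *m w1 + v1 *m w0) *m (v0 *m w1 + v1 *m w0)) = 2.
Proof.
move=> w00 w11 w01 w10; rewrite mxtrace_mulC mulmxDl !mulmxDr.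
have E (a c : 'cV[D]_n) (b d : 'rV[D]_n) : a *m b *m (c *m d) = a *m (b *m c) *m d.
  by rewrite !mulmxA.
rewrite !E w00 w11 w01 w10 !mulmx1 !mulmx0 !mul0mx add0r addr0 mxtraceD.
by rewrite (mxtrace_mulC v0) (mxtrace_mulC v1) w00 w11 !mxtrace1.
Qed.

End MatrixAlgebra.

(** * Adjoints and the Hilbert-Schmidt inner product *)

Section Adjoint.
Variable R : rcfType.
Local Notation C := R[i].

Lemma adjmxD m n (A B : 'M[C]_(m, n)) : adjmx (A + B) = adjmx A + adjmx B.
Proof. by rewrite /adjmx /conjmx_entry linearD map_mxD. Qed.

Lemma adjmxN m n (A : 'M[C]_(m, n)) : adjmx (- A) = - adjmx A.
Proof. by rewrite /adjmx /conjmx_entry linearN map_mxN. Qed.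

Lemma adjmx_delta m n i j : adjmx (delta_mx i j : 'M[C]_(m, n)) = delta_mx j i.
Proof. by rewrite /adjmx /conjmx_entry trmx_delta map_delta_mx. Qed.

Lemma adjmx1 n : adjmx (1%:M : 'M[C]_n) = 1%:M.
Proof. by rewrite /adjmx /conjmx_entry trmx1 map_mx1. Qed.

Lemma adjmxM m n p (A : 'M[C]_(m, n)) (B : 'M[C]_(n, p)) :
  adjmx (A *m B) = adjmx B *m adjmx A.
Proof. by rewrite /adjmx /conjmx_entry trmx_mul map_mxM. Qed.

Lemma adjmxK m n (A : 'M[C]_(m, n)) : adjmx (adjmx A) = A.
Proof. by apply/matrixP => i j; rewrite !mxE conjCK. Qed.

Lemma conjC_real (x : R) : (x%:C)^* = x%:C :> C.
Proof. by apply/eqP; rewrite eq_complex /= oppr0 !eqxx. Qed.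

Lemma adjmxZ_real m n (x : R) (A : 'M[C]_(m, n)) :
  adjmx (x%:C *: A) = x%:C *: adjmx A.
Proof. by apply/matrixP => i j; rewrite !mxE rmorphM /= conjC_real. Qed.

Lemma adjmx_tens m n p q (A : 'M[C]_(m, n)) (B : 'M[C]_(p, q)) :
  adjmx (A *t B) = adjmx A *t adjmx B.
Proof. by rewrite /adjmx /conjmx_entry trmx_tens map_mxT. Qed.

Lemma adjmx_mul_vecmx m n (A B : 'M[C]_(m, n)) :
  adjmx (vecmx A) *m vecmx B = (\tr (adjmx A *m B))%:M.
Proof.
apply/matrixP => i j; rewrite !ord1 mxE sum_mxtens_index exchange_big mxE mulr1n.
apply: eq_bigr => k _; rewrite mxE; apply: eq_bigr => l _.
by rewrite !mxE mxtens_indexK.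
Qed.

End Adjoint.

(** * Concurrence *)

Section Concurrence.
Variable R : realType.
Local Notation C := R[i].

Lemma proj_onE n (v : 'cV[C]_n) i j : proj_on v i j = v i 0 * (v j 0)^*.
Proof. by rewrite mxE big_ord1 !mxE. Qed.

(** [eigenvalues] is a chosen list of roots; unique factorization determines it up to order, which
    suffices because the spectrum gets sorted. *)
Lemma perm_eigenvalues n (A : 'M[C]_n) (s : seq C) :
  char_poly A = \prod_(x <- s) ('X - x%:P) -> perm_eq (eigenvalues A) s.
Proof.
move=> As; apply: prod_XsubC_eq; rewrite -As /eigenvalues.
case: closed_field_poly_normal => /= r rE.
by rewrite [RHS]rE (monicP (char_poly_monic A)) scale1r.
Qed.

(** The matrix has eigenvalues [t ^+ 2] once and [z ^+ 2] three times, and [z <= t] puts [t] first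
    after sorting. *)
Lemma concurrence_rank1 (rho : 'M[C]_(2 * 2)) (z t : R)
    (u : 'cV[C]_(2 * 2)) (w : 'rV[C]_(2 * 2)) :
  0 <= z <= t ->
  rho *m (sigma2 R *t sigma2 R) *m conjmx_entry rho *m (sigma2 R *t sigma2 R)
    = (z ^+ 2)%:C%:M + u *m w ->
  (w *m u) 0 0 = (t ^+ 2 - z ^+ 2)%:C ->
  concurrence rho = Num.max 0 (t - z - z - z).
Proof.
move=> /andP[z0 zt] rhoE wu; have t0 := le_trans z0 zt.
rewrite /concurrence /wootters_spectrum rhoE.
set e := eigenvalues _.
have pe : perm_eq e [:: (t ^+ 2)%:C; (z ^+ 2)%:C; (z ^+ 2)%:C; (z ^+ 2)%:C].
  apply: perm_eigenvalues; rewrite (@char_poly_scalar_add_rank1 _ 3) wu.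
  have -> : (z ^+ 2)%:C + (t ^+ 2 - z ^+ 2)%:C = (t ^+ 2)%:C.
    by rewrite -rmorphD /= addrC subrK.
  rewrite !big_cons big_nil mulr1 mulrC.
  by congr (_ * _); rewrite [LHS]exprS [in LHS]expr2.
have -> : sort >=%R [seq Num.sqrt (complex.Re x) | x <- e] = [:: t; z; z; z].
  rewrite (perm_sortP _ _ _ _ _ (perm_map _ pe)).
  - rewrite /= !sqrtr_sqr !ger0_norm //; apply: sorted_sort.
      by move=> x y a /= yx xa; apply: le_trans xa yx.
    by rewrite /= zt !lexx.
  - by move=> x y /=; apply: le_total.
  - by move=> x y a /= yx xa; apply: le_trans xa yx.
  - by move=> x y /=; rewrite andbC; apply: le_anti.
by [].
Qed.

Lemma sigma2E :
  sigma2 R = - 'i%C *: delta_mx 0 1 + 'i%C *: delta_mx 1 0.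
Proof.
by rewrite /sigma2 /ket_up /ket_down !adjmx_delta !mul_delta_mx.
Qed.

Lemma adjmx_sigma2 : adjmx (sigma2 R) = sigma2 R.
Proof.
rewrite sigma2E; apply: mx2P; rewrite !mxE /=;
  by apply/eqP; rewrite eq_complex /=; apply/andP; split; apply/eqP; ring.
Qed.

Lemma sigma2_sqr : sigma2 R *m sigma2 R = 1%:M.
Proof.
rewrite sigma2E; set I := 'i%C; have II : I * I = -1 by rewrite -expr2 sqr_i.
by apply: mx2P; rewrite !mulmx2E !mxE /=; ring: II.
Qed.

Lemma sigma2_diag (a b : C) :
  sigma2 R *m (a *: delta_mx 0 0 + b *: delta_mx 1 1) *m (sigma2 R)^T
    = - (b *: delta_mx 0 0 + a *: delta_mx 1 1).
Proof.
by apply: conj_diag_antidiag sigma2E; rewrite -expr2 sqr_i.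
Qed.

Local Notation S := (sigma2 R *t sigma2 R).

Lemma assoc_spinflip (A B : 'M[C]_(2 * 2)) :
  A *m S *m B *m S = A *m (S *m B *m S).
Proof. by rewrite !mulmxA. Qed.

Lemma adjmx_spinflip : adjmx S = S.
Proof. by rewrite adjmx_tens !adjmx_sigma2. Qed.

Lemma spinflip_sqr : S *m S = 1%:M.
Proof. by rewrite tensmx_mul sigma2_sqr tensmx11. Qed.

Definition diag2 (a b : R) : 'M[C]_2 :=
  a%:C *: delta_mx 0 0 + b%:C *: delta_mx 1 1.

Lemma spinflip_diag2 (a b : R) :
  S *m vecmx (diag2 a b) = - vecmx (diag2 b a).
Proof.
rewrite mul_tensmx_vecmx sigma2_diag.
by apply/matrixP => i j; rewrite !mxE.
Qed.

Lemma conj_vecmx_diag2 (a b : R) :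
  conjmx_entry (vecmx (diag2 a b)) = vecmx (diag2 a b).
Proof.
apply/matrixP => i j; rewrite !mxE rmorphD !rmorphM /= !conjC_real.
by rewrite !conjC_nat.
Qed.

Lemma conj_proj_diag2 (a b : R) :
  conjmx_entry (proj_on (vecmx (diag2 a b))) = proj_on (vecmx (diag2 a b)).
Proof.
have E i : (vecmx (diag2 a b) i 0)^* = vecmx (diag2 a b) i 0.
  by have /matrixP/(_ i 0) := conj_vecmx_diag2 a b; rewrite mxE.
by apply/matrixP => i j; rewrite mxE !proj_onE rmorphM /= !E.
Qed.

(** The spin flip swaps the two coefficients up to a sign, which cancels between ket and bra. *)
Lemma spinflip_proj_diag2 (a b : R) :
  S *m proj_on (vecmx (diag2 a b)) *m S = proj_on (vecmx (diag2 b a)).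
Proof.
(* The right factor [S] is replaced by its adjoint, so that it acts on the bra as the left one does
   on the ket. *)
rewrite /proj_on !mulmxA spinflip_diag2 -mulmxA -{1}adjmx_spinflip -adjmxM.
by rewrite spinflip_diag2 adjmxN mulNmx mulmxN opprK.
Qed.

Lemma dot_diag2 (a b a' b' : R) :
  adjmx (vecmx (diag2 a b)) *m vecmx (diag2 a' b') = (a * a' + b * b')%:C%:M.
Proof.
rewrite adjmx_mul_vecmx; congr (_ %:M).
rewrite adjmxD !adjmxZ_real !adjmx_delta tr_mul_diag.
by rewrite !rmorphD !rmorphM.
Qed.

(** The product of the two projections has rank one, and its nonzero eigenvalue is the square of the
    overlap [2 * a * b] of [v] and [v']. *)
Lemma concurrence_diag2 (a b : R) :
  0 <= a -> 0 <= b -> concurrence (proj_on (vecmx (diag2 a b))) = 2 * a * b.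
Proof.
move=> a0 b0.
set v := vecmx (diag2 a b); set v' := vecmx (diag2 b a).
have t0 : 0 <= 2 * a * b by rewrite !mulr_ge0.
rewrite (@concurrence_rank1 _ 0 (2 * a * b) v (adjmx v *m proj_on v')).
- by rewrite !subr0 max_r.
- by rewrite lexx t0.
- rewrite conj_proj_diag2 assoc_spinflip spinflip_proj_diag2.
  by rewrite expr0n rmorph0 add0r [RHS]mulmxA.
- have vv' : adjmx v *m v' = _ := dot_diag2 a b b a.
  have v'v : adjmx v' *m v = _ := dot_diag2 b a a b.
  rewrite /proj_on (mulmxA (adjmx v) v') vv' -(mulmxA _ (adjmx v') v) v'v.
  rewrite -scalar_mxM -(rmorphM (real_complex R)) mxE mulr1n.
  by congr (_%:C); ring.
Qed.

(** The state is fixed both by conjugation and by the spin flip, so the Wootters matrix is its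
    square. *)
Lemma concurrence_isotropic (z y : R) :
  0 <= z -> 0 <= y ->
  concurrence (z%:C%:M + y%:C *: proj_on (vecmx (diag2 1 1)))
    = Num.max 0 (2 * y - 2 * z).
Proof.
move=> z0 y0; set v := vecmx (diag2 1 1).
have conj_rho : conjmx_entry (z%:C%:M + y%:C *: proj_on v) = z%:C%:M + y%:C *: proj_on v.
  rewrite /conjmx_entry map_mxD map_mxZ map_scalar_mx -/(conjmx_entry _).
  by rewrite conj_proj_diag2 /= !conjC_real.
(* As [v] has squared norm 2, the state has eigenvalue [z + 2 * y] on [v] and [z] on the orthogonal
   complement; the coefficient of [adjmx v] comes from expanding the square. *)
rewrite (@concurrence_rank1 _ z (z + 2 * y) v
  ((2 * z * y + 2 * y ^+ 2)%:C *: adjmx v)).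
- by congr Num.max; ring.
- by rewrite z0 lerDl mulr_ge0.
- rewrite conj_rho assoc_spinflip.
  rewrite mulmxDr mulmxDl mul_mx_scalar -scalemxAl spinflip_sqr.
  rewrite -scalemxAr -scalemxAl spinflip_proj_diag2 scalemx1.
  rewrite mulmxDl !mulmxDr -scalar_mxM mul_mx_scalar mul_scalar_mx.
  have -> : (y%:C *: proj_on v) *m (y%:C *: proj_on v)
    = (2 * y ^+ 2)%:C *: proj_on v.
    rewrite -scalemxAl -scalemxAr scalerA /proj_on mulmxA -[_ *m v]mulmxA.
    rewrite dot_diag2 mul_mx_scalar -scalemxAl scalerA -!rmorphM /=.
    by congr (_%:C *: _); ring.
  rewrite -!addrA; congr (_ + _); first by rewrite -rmorphM.
  rewrite -scalemxAr -/(proj_on v) !scalerA -!scalerDl -!rmorphM -!rmorphD /=.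
  by congr (_%:C *: _); ring.
- rewrite -scalemxAl dot_diag2 !mxE mulr1n -rmorphM /=.
  by congr (_%:C); ring.
Qed.

End Concurrence.

(** * Effect of a measurement *)

Section Discord.
Variable R : realType.
Local Notation C := R[i].

(** The trace equals its own conjugate, so taking the real part loses nothing. *)
Lemma hs_normsqE n (A : 'M[C]_n) : (hs_normsq A)%:C = \tr (A *m adjmx A).
Proof.
suff /eqP : (\tr (A *m adjmx A))^* = \tr (A *m adjmx A).
  by rewrite eq_complex /hs_normsq; case: (\tr _) => x y /= /andP[_ /eqP h];
    apply/eqP; rewrite eq_complex /= eqxx /=; lra.
rewrite /mxtrace rmorph_sum; apply: eq_bigr => i _.
by rewrite !mxE rmorph_sum; apply: eq_bigr => j _; rewrite !mxE rmorphM /= conjCK mulrC.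
Qed.

Lemma hs_normsq_ge0 n (A : 'M[C]_n) : 0 <= hs_normsq A.
Proof.
rewrite -(@ler0c R) hs_normsqE; apply: sumr_ge0 => i _; rewrite mxE; apply: sumr_ge0 => j _.
by rewrite !mxE mul_conjC_ge0.
Qed.

Lemma projective_measurement_mul (P : 'I_2 -> 'M[C]_2) :
  projective_measurement P ->
  forall i j, P i *m P j = if i == j then P i else 0.
Proof.
move=> [Prk]; rewrite sum_ord2 => Psum.
have PP i : P i *m P i = P i by case: (Prk i).
have P1 : P 1 = 1%:M - P 0 by rewrite -Psum addrC addrK.
have P01 : P 0 *m P 1 = 0 by rewrite P1 mulmxBr mulmx1 PP subrr.
have P10 : P 1 *m P 0 = 0 by rewrite P1 mulmxBl mul1mx PP subrr.
by move=> i j; case: (ord2P i) => ->; case: (ord2P j) => ->; rewrite /= ?PP.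
Qed.

(** The inner products are traces of [P i *m P j], and an idempotent of rank 1 has trace 1. *)
Lemma projective_measurement_dot (P : 'I_2 -> 'M[C]_2) :
  projective_measurement P ->
  forall i j, adjmx (vecmx (P i)) *m vecmx (P j) = (i == j)%:R%:M.
Proof.
move=> mP i j; have [Prk _] := mP; have [PP Pa rk] := Prk i.
rewrite adjmx_mul_vecmx Pa projective_measurement_mul //.
by case: eqP => _; rewrite ?mxtrace0 // mxtrace_idempotent // rk.
Qed.

(** Each outcome keeps one component of [v], so only the two cross terms are lost; they form [N],
    whose squared norm is 2. *)
Lemma measured_distance (P : 'I_2 -> 'M[C]_2) (z y a b : R) :
  projective_measurement P ->
  let rho := z%:C%:M + y%:C *: proj_on (vecmx (a%:C *: P 0 + b%:C *: P 1)) in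
  hs_normsq (rho - post_measurement P rho) = 2 * (y * a * b) ^+ 2.
Proof.
move=> mP /=; set v := vecmx _.
have [Prk Psum] := mP; have PiPj := projective_measurement_mul mP.
pose v0 := vecmx (P 0); pose v1 := vecmx (P 1).
have dot := projective_measurement_dot mP.
have vE : v = a%:C *: v0 + b%:C *: v1 by apply/matrixP => i j; rewrite !mxE.
pose A i : 'M[C]_(2 * 2) := P i *t 1%:M.
have adjA i : adjmx (A i) = A i.
  by rewrite adjmx_tens; case: (Prk i) => _ -> _; rewrite adjmx1.
have Av0 : A 0 *m v = a%:C *: v0.
  rewrite mul_tensmx_vecmx trmx1 mulmx1 mulmxDr -!scalemxAr !PiPj /= scaler0 addr0.
  by apply/matrixP => i j; rewrite !mxE.
have Av1 : A 1 *m v = b%:C *: v1.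
  rewrite mul_tensmx_vecmx trmx1 mulmx1 mulmxDr -!scalemxAr !PiPj /= scaler0 add0r.
  by apply/matrixP => i j; rewrite !mxE.
have sumA : \sum_i A i = 1%:M by rewrite sum_ord2 -tensmxDl -sum_ord2 Psum tensmx11.
have AA i : A i *m A i = A i by rewrite tensmx_mul mulmx1 PiPj eqxx.
have Aproj i : A i *m proj_on v *m A i = proj_on (A i *m v).
  by rewrite /proj_on adjmxM adjA !mulmxA.
pose N := v0 *m adjmx v1 + v1 *m adjmx v0.
have postE : z%:C%:M + y%:C *: proj_on v
    - post_measurement P (z%:C%:M + y%:C *: proj_on v) = (y * a * b)%:C *: N.
  rewrite /post_measurement (sub_pinching _ _ _ AA sumA) sum_ord2 !Aproj Av0 Av1.
  rewrite /proj_on vE adjmxD !adjmxZ_real sub_pinching_rank1 scalerA.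
  by congr (_ *: _); rewrite -mulrA !rmorphM.
apply: (@complexI R); rewrite postE hs_normsqE adjmxZ_real.
have -> : adjmx N = N by rewrite /N adjmxD !adjmxM !adjmxK addrC.
rewrite -scalemxAl -scalemxAr !mxtraceZ mxtrace_cross_sqr ?dot ?raddf0 //.
by rewrite expr2 !rmorphM /= rmorph_nat; ring.
Qed.

End Discord.

(** * Bounds on the geometric discord *)

Section DiscordBounds.
Variable R : realType.
Local Notation C := R[i].

Lemma projective_measurement_std :
  projective_measurement (fun i => delta_mx i i : 'M[C]_2).
Proof.
split=> [i|]; first by split; rewrite ?mul_delta_mx ?adjmx_delta ?mxrank_delta.
by rewrite sum_ord2; apply: mx2P; rewrite !mxE /= ?addr0 ?add0r.
Qed.

Lemma geometric_discord_le (P : 'I_2 -> 'M[C]_2) (rho : 'M[C]_(2 * 2)) :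
  projective_measurement P ->
  geometric_discord rho <= hs_normsq (rho - post_measurement P rho).
Proof.
move=> mP; apply: ge_inf; last by exists P.
(* The infimum bounds the elements from below only once the set is known to be bounded below; 0
   serves. *)
by exists 0 => _ [Q _ <-]; exact: hs_normsq_ge0.
Qed.

Lemma geometric_discord_ge (rho : 'M[C]_(2 * 2)) (x : R) :
  (forall P, projective_measurement P -> x <= hs_normsq (rho - post_measurement P rho)) ->
  x <= geometric_discord rho.
Proof.
move=> xle; apply: lb_le_inf; last by move=> _ [P mP <-]; exact: xle.
(* The infimum is a greatest lower bound only for a nonempty set; the standard measurement provides
   an element. *)
by eexists; exists (fun i => delta_mx i i) => //; exact: projective_measurement_std.
Qed.

Lemma geometric_discord_diag2_le (a b : R) :
  geometric_discord (proj_on (vecmx (diag2 a b))) <= 2 * (a * b) ^+ 2.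
Proof.
apply: le_trans (geometric_discord_le _ projective_measurement_std) _.
(* A pure state is the case [z = 0], [y = 1] of [measured_distance]. *)
have -> : proj_on (vecmx (diag2 a b)) = 0%:C%:M + 1%:C *: proj_on (vecmx (diag2 a b)).
  by rewrite scale1r -[0%:C]/(0 : C) -[0%:M]scalemx1 scale0r add0r.
by rewrite (measured_distance 0 1 a b projective_measurement_std) mul1r.
Qed.

(** The identity is [P 0 + P 1] for every measurement, so all of them move the state by the same
    distance. *)
Lemma geometric_discord_isotropic_ge (z y : R) :
  2 * y ^+ 2 <= geometric_discord (z%:C%:M + y%:C *: proj_on (vecmx (diag2 1 1))).
Proof.
apply: geometric_discord_ge => P mP.
have -> : diag2 1 1 = 1%:C *: P 0 + 1%:C *: P 1.
  rewrite !scale1r -sum_ord2 (proj2 mP) -(proj2 projective_measurement_std).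
  by rewrite sum_ord2 /diag2 !scale1r.
by rewrite (measured_distance z y 1 1 mP) !mulr1.
Qed.

End DiscordBounds.

(** * Haar integration on SU(2) *)

Section Continuity.
Variable R : realType.
Local Notation C := R[i].

Lemma normc_Re_le (z : C) : (`|complex.Re z|)%:C <= `|z|.
Proof.
case: z => a b; rewrite normc_def lecR /= -[leLHS]sqrtr_sqr.
by apply: ler_wsqrtr; rewrite lerDl sqr_ge0.
Qed.

Lemma normc_Im_le (z : C) : (`|complex.Im z|)%:C <= `|z|.
Proof.
case: z => a b; rewrite normc_def lecR /= -[leLHS]sqrtr_sqr.
by apply: ler_wsqrtr; rewrite lerDr sqr_ge0.
Qed.

Lemma Re_continuous : continuous (@complex.Re R : C -> R).
Proof.
move=> z A /nbhs_ballP[e /= e0 sA]; apply/nbhs_ballP; exists e%:C.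
  by rewrite /= ltcR.
move=> w; rewrite -ball_normE /= => zw; apply: sA; rewrite -ball_normE /= -raddfB -ltcR.
exact: le_lt_trans (normc_Re_le _) zw.
Qed.

Lemma Im_continuous : continuous (@complex.Im R : C -> R).
Proof.
move=> z A /nbhs_ballP[e /= e0 sA]; apply/nbhs_ballP; exists e%:C.
  by rewrite /= ltcR.
move=> w; rewrite -ball_normE /= => zw; apply: sA; rewrite -ball_normE /= -raddfB -ltcR.
exact: le_lt_trans (normc_Im_le _) zw.
Qed.

Lemma mx_entry_continuous (T : topologicalType) m n i j :
  continuous (fun M : 'M[T]_(m, n) => M i j).
Proof.
(* Neighborhoods of a matrix are products of neighborhoods of its entries: constrain one entry,
   leave the others free. *)
move=> M A MA; exists (fun k l => if (k == i) && (l == j) then A else setT).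
  move=> k l; case: ifP => [/andP[/eqP -> /eqP ->] //|_]; exact: filterT.
by move=> N /(_ i j); rewrite /= !eqxx.
Qed.

Lemma mx_continuous (S T : topologicalType) m n (f : S -> 'M[T]_(m, n)) :
  (forall i j, continuous (fun x => f x i j)) -> continuous f.
Proof.
move=> cf x A [P Pn PA]; rewrite /nbhs /=.
have : \forall y \near x, forall i j, P i j (f y i j).
  by apply: filter_forall => i; apply: filter_forall => j; apply: cf; exact: Pn.
by apply: filterS => y Py; exact: PA.
Qed.

Lemma mulmx_continuous (S : topologicalType) m n p (f : S -> 'M[C]_(m, n))
    (g : S -> 'M[C]_(n, p)) :
  continuous f -> continuous g -> continuous (fun x => f x *m g x).
Proof.
move=> cf cg; apply: mx_continuous => i j.
have -> : (fun x => (f x *m g x) i j) = fun x => \sum_k f x i k * g x k j.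
  by apply/funext => x; rewrite mxE.
apply: continuous_big => [|k _ x]; first exact: add_continuous.
apply: cvgM.
- exact: (@continuous_comp _ _ _ f (fun M => M i k) x (cf x) (@mx_entry_continuous _ _ _ _ _ _)).
- exact: (@continuous_comp _ _ _ g (fun M => M k j) x (cg x) (@mx_entry_continuous _ _ _ _ _ _)).
Qed.

Lemma conjC_continuous : continuous (Num.conj : C -> C).
Proof.
move=> z A /nbhs_ballP[e /= e0 sA]; apply/nbhs_ballP; exists e => //= w.
rewrite -ball_normE /= => zw; apply: sA.
by rewrite -ball_normE /= -rmorphB norm_conjC.
Qed.

Lemma adjmx_continuous m n : continuous (@adjmx R m n).
Proof.
apply: mx_continuous => i j.
have -> : (fun A : 'M[C]_(m, n) => adjmx A i j) = fun A => (A j i)^*.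
  by apply/funext => A; rewrite !mxE.
move=> A; apply: (@continuous_comp _ _ _ (fun M : 'M[C]_(m, n) => M j i) Num.conj A).
  exact: mx_entry_continuous.
exact: conjC_continuous.
Qed.

End Continuity.

(** * Translation invariance of the Haar integral *)

Section HaarIntegral.
Variable R : realType.
Local Notation C := R[i].
Local Notation G := (SU2_borel R).
Local Notation T := (@SU2 R).

Lemma continuous_SU2_measurable (f : T -> R) :
  continuous f -> measurable_fun [set: G] (f : G -> R).
Proof.
move=> /continuousP cf; apply: (measurability _ (RGenOpens.measurableE R)).
move=> _ [_ [a [b ->] <-]]; rewrite setTI; apply: sub_sigma_algebra.
exact/cf/interval_open.
Qed.

Lemma SU2_val_continuous : continuous (\val : T -> 'M[C]_2).
Proof. exact: initial_continuous. Qed.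

Lemma SU2_mulg_continuous (V : T) : continuous (SU2_mulg V : T -> T).
Proof.
apply: continuous_comp_initial.
apply: (@mulmx_continuous _ _ _ _ _ (fun=> \val V)); last exact: SU2_val_continuous.
exact: cst_continuous.
Qed.

Lemma SU2_mulg_measurable (V : T) :
  measurable_fun [set: G] (SU2_mulg V : G -> G).
Proof.
apply: (@measurability _ _ G G _ _ (@open T)) => //.
move=> _ [B oB <-]; rewrite setTI; apply: sub_sigma_algebra.
by have /continuousP := @SU2_mulg_continuous V; exact.
Qed.

Lemma SU2_mul_adj (U : 'M[C]_2) : T U -> U *m adjmx U = 1%:M.
Proof. by move=> [/unitarymxP]. Qed.

Lemma SU2_adj_mul (U : 'M[C]_2) : SU2 U -> adjmx U *m U = 1%:M.
Proof. by move=> hU; apply: mulmx1C; apply: SU2_mul_adj. Qed.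

Lemma SU2_adj (U : 'M[C]_2) : T U -> T (adjmx U).
Proof.
move=> hU; have UU := SU2_mul_adj hU; have [_ dU] := hU; split.
  apply/unitarymxP; apply: etrans (mulmx1C UU); congr (_ *m _); exact: adjmxK.
by have := congr1 determinant UU; rewrite det_mulmx dU mul1r det1.
Qed.

Lemma SU2_mulg_surj (V U : T) : exists W, SU2_mulg V W = U.
Proof.
exists (SU2_mulg (SigSub (mem_set (SU2_adj (set_valP V)))) U).
apply: val_inj => /=; rewrite mulmxA SU2_mul_adj ?mul1mx //; exact: set_valP.
Qed.

Variable mu : probability G R.
Hypothesis Hmu : normalized_haar mu.

(** Invariance is assumed for images, whereas a change of variables needs preimages; surjectivity of
    the translation links the two. *)
Lemma haar_preimage (V : T) (A : set G) : measurable A ->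
  mu (SU2_mulg V @^-1` A) = mu A.
Proof.
move=> mA.
have mpA : measurable (SU2_mulg V @^-1` A : set G).
  by rewrite -[X in measurable X]setTI; exact: SU2_mulg_measurable.
rewrite -(Hmu V mpA); congr (mu _); apply/seteqP; split=> [_ [W AW <-] //|U AU].
by have [W WU] := SU2_mulg_surj V U; exists W => //=; rewrite WU.
Qed.

Lemma continuous_bounded_integrable (f : T -> R) (M : R) :
  continuous f -> (forall U, `|f U| <= M) ->
  mu.-integrable setT (EFin \o (f : G -> R)).
Proof.
move=> cf fM; apply: measurable_bounded_integrable => //.
- exact: fin_num_fun_lty.
- exact: continuous_SU2_measurable.
- exists M; split; first exact: num_real.
  by move=> x Mx U _; apply: le_trans (fM U) _; exact: ltW.
Qed.

(** By invariance [mu] is its own pushforward under the translation. The bound [M] supplies the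
    integrability that the change of variables requires. *)
Lemma haar_Rintegral (V : T) (f : T -> R) (M : R) :
  continuous f -> (forall U, `|f U| <= M) ->
  Rintegral mu setT (fun U : G => f (SU2_mulg V U)) = Rintegral mu setT (f : G -> R).
Proof.
move=> cf fM; rewrite /Rintegral; congr fine.
have mV := SU2_mulg_measurable V.
rewrite -[RHS](@eq_measure_integral _ _ _ setT mu (pushforward mu (SU2_mulg V : G -> G))); last first.
  by move=> A mA _; exact: haar_preimage.
rewrite integral_pushforward //.
- by apply/measurable_EFinP; exact: continuous_SU2_measurable.
- apply: (@continuous_bounded_integrable (f \o SU2_mulg V) M) => [U|U]; last exact: fM.
  apply: continuous_comp; [exact: SU2_mulg_continuous|exact: cf].
Qed.

End HaarIntegral.

(** * Moments of the Bloch vector *)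

Section Matrix22.

Definition mx22 (T : Type) (a b c d : T) : 'M[T]_2 :=
  \matrix_(i, j) if i == 0 then (if j == 0 then a else b)
                 else (if j == 0 then c else d).

Lemma mul_mx22 (D : pzSemiRingType) (a b c d a' b' c' d' : D) :
  mx22 a b c d *m mx22 a' b' c' d'
    = mx22 (a * a' + b * c') (a * b' + b * d') (c * a' + d * c') (c * b' + d * d').
Proof. by apply: mx2P; rewrite mulmx2E !mxE. Qed.

Lemma det_mx22 (D : comPzRingType) (a b c d : D) :
  \det (mx22 a b c d) = a * d - b * c.
Proof.
rewrite (expand_det_row _ 0) sum_ord2 /cofactor !det_mx11 !mxE /=.
by rewrite expr0 expr1 mul1r mulN1r mulrN.
Qed.

Lemma mx22_eta (T : Type) (A : 'M[T]_2) : A = mx22 (A 0 0) (A 0 1) (A 1 0) (A 1 1).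
Proof. by apply: mx2P; rewrite mxE. Qed.

(* [x * sigma_1 + y * sigma_2 + z * sigma_3], for [I] the imaginary unit. *)
Definition spin (D : comPzRingType) (I x y z : D) : 'M[D]_2 :=
  mx22 z (x - I * y) (x + I * y) (- z).

Lemma spin_linear (D : comPzRingType) (I x y z : D) :
  spin I x y z = x *: spin I 1 0 0 + y *: spin I 0 1 0 + z *: spin I 0 0 1.
Proof. by apply: mx2P; rewrite !mxE /=; ring. Qed.

Lemma diag_mx22 (D : comPzRingType) (x y : D) :
  (x + y) *: delta_mx 0 0 + (x - y) *: delta_mx 1 1
    = x *: 1%:M + y *: (delta_mx 0 0 - delta_mx 1 1) :> 'M[D]_2.
Proof. by apply: mx2P; rewrite !mxE /=; ring. Qed.

(** Completeness of the Pauli basis. The swapped indices [j2 j1] play the part of complex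
    conjugation, the Pauli matrices being Hermitian. *)
Lemma fierz (D : comPzRingType) (I : D) (i1 i2 j1 j2 : 'I_2) : I * I = -1 ->
  1%:M i1 i2 * 1%:M j2 j1 + spin I 1 0 0 i1 i2 * spin I 1 0 0 j2 j1
    + spin I 0 1 0 i1 i2 * spin I 0 1 0 j2 j1
    + spin I 0 0 1 i1 i2 * spin I 0 0 1 j2 j1
  = ((i1 == j1) && (i2 == j2))%:R * 2.
Proof.
move=> II; case: (ord2P i1) => ->; case: (ord2P i2) => ->;
  by case: (ord2P j1) => ->; case: (ord2P j2) => ->; rewrite !mxE /=; ring: II.
Qed.

Lemma spin_sqr (D : comPzRingType) (I x y z : D) : I * I = -1 ->
  spin I x y z *m spin I x y z = (x ^+ 2 + y ^+ 2 + z ^+ 2)%:M.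
Proof. by move=> II; rewrite !mul_mx22; apply: mx2P; rewrite !mxE /=; ring: II. Qed.

(* Conjugation by [I * sigma_1], the half turn about the first axis. *)
Lemma spin_half_turn (D : comPzRingType) (I x y z : D) : I * I = -1 ->
  mx22 0 I I 0 *m spin I x y z *m mx22 0 (- I) (- I) 0 = spin I x (- y) (- z).
Proof. by move=> II; rewrite !mul_mx22; apply: mx2P; rewrite !mxE /=; ring: II. Qed.

(* Conjugation by [(1 + I * (sigma_1 + sigma_2 + sigma_3)) / 2], which turns the
   Bloch sphere about the axis (1, 1, 1) by a third of a full turn. *)
Lemma spin_cyclic_turn (D : comPzRingType) (I h x y z : D) :
  I * I = -1 -> h * 2 = 1 ->
  mx22 (h * (1 + I)) (h * (1 + I)) (h * (-1 + I)) (h * (1 - I)) *m spin I x y z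
    *m mx22 (h * (1 - I)) (h * (-1 - I)) (h * (1 - I)) (h * (1 + I))
  = spin I y z x.
Proof.
(* [h] is known only through [h * 2 = 1]; inserting [h * h * 4] on the right makes both sides
   quadratic in [h], within reach of [ring]. *)
move=> II hh; have hh4 (t : D) : t = h * h * 4 * t.
  by transitivity ((h * 2) * (h * 2) * t); [rewrite hh !mul1r|ring].
by rewrite !mul_mx22; apply: mx2P; rewrite !mxE /= [RHS]hh4; ring: II.
Qed.

End Matrix22.

(** * The Bloch vector of a rotated third Pauli matrix *)

Section Bloch.
Variable R : realType.
Local Notation C := R[i].
Local Notation T := (@SU2 R).

Definition rotated_sz (U : 'M[C]_2) : 'M[C]_2 :=
  U *m (delta_mx 0 0 - delta_mx 1 1) *m adjmx U.

(** Coordinates along sigma_1, sigma_2, sigma_3; the minus sign is that of the entry [x - I * y] of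
    [spin]. *)
Definition bloch (U : 'M[C]_2) (k : 'I_3) : R :=
  let M := rotated_sz U in
  [tuple complex.Re (M 0 1); - complex.Im (M 0 1); complex.Re (M 0 0)]`_k.

Lemma adjmx_rotated_sz U : adjmx (rotated_sz U) = rotated_sz U.
Proof.
by rewrite /rotated_sz !adjmxM adjmxK adjmxD adjmxN !adjmx_delta !mulmxA.
Qed.

Lemma tr_rotated_sz U : SU2 U -> \tr (rotated_sz U) = 0.
Proof.
move=> hU; rewrite /rotated_sz mxtrace_mulC mulmxA SU2_adj_mul // mul1mx.
by rewrite mxtrace2E !mxE /= subr0 sub0r subrr.
Qed.

Lemma rotated_sz_sqr U : SU2 U -> rotated_sz U *m rotated_sz U = 1%:M.
Proof.
move=> hU; rewrite /rotated_sz -!mulmxA [adjmx U *m (U *m _)]mulmxA SU2_adj_mul //.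
rewrite mul1mx [X in U *m X]mulmxA.
suff -> : (delta_mx 0 0 - delta_mx 1 1 : 'M[C]_2)
    *m (delta_mx 0 0 - delta_mx 1 1 : 'M[C]_2) = 1%:M.
  by rewrite mul1mx SU2_mul_adj.
rewrite mulmxBl !mulmxBr !mul_delta_mx_cond /= !mulr0n !mulr1n subr0 sub0r opprK.
by apply: mx2P; rewrite !mxE /= ?(addr0, add0r).
Qed.

(** A traceless Hermitian matrix is a real combination of the Pauli matrices. *)
Lemma rotated_szE U : SU2 U ->
  rotated_sz U = spin 'i%C (bloch U 0)%:C (bloch U 1)%:C (bloch U 2)%:C.
Proof.
move=> hU; have := adjmx_rotated_sz U; have := tr_rotated_sz hU.
rewrite /bloch /=; set M := rotated_sz U; rewrite mxtrace2E => trM adjM.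
have M10 : M 1 0 = (M 0 1)^* by rewrite -[in LHS]adjM !mxE.
have M00 : M 0 0 = (M 0 0)^* by rewrite -[in LHS]adjM !mxE.
have M11 : M 1 1 = - M 0 0 by apply/eqP; rewrite -addr_eq0 addrC trM.
have Im0 : complex.Im (M 0 0) = 0.
  move/eqP: M00; rewrite eq_complex => /andP[_ /eqP].
  by case: (M 0 0) => a b /=; lra.
have M00E : (complex.Re (M 0 0))%:C = M 0 0.
  by apply/eqP; rewrite eq_complex /= eqxx Im0 eqxx.
rewrite [LHS]mx22_eta M11 M10 /spin M00E.
congr (mx22 _ _ _ _); case: (M 0 1) => a b; apply/eqP; rewrite eq_complex /=;
  by apply/andP; split; apply/eqP; ring.
Qed.

Lemma bloch_sqr U : SU2 U -> bloch U 0 ^+ 2 + bloch U 1 ^+ 2 + bloch U 2 ^+ 2 = 1.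
Proof.
move=> hU; have /matrixP/(_ 0 0) := rotated_sz_sqr hU.
rewrite rotated_szE // spin_sqr ?mxE; last by rewrite -expr2 sqr_i.
by rewrite mulr1n -!rmorphXn -!rmorphD => /(@complexI R).
Qed.

(** A component of a unit vector; this is the bound that makes the moments integrable. *)
Lemma bloch_le1 U k : SU2 U -> `|bloch U k| <= 1.
Proof.
move=> hU; rewrite -(@ler_pXn2r _ 2) ?nnegrE // expr1n real_normK ?num_real //.
rewrite -(bloch_sqr hU).
have x2 := sqr_ge0 (bloch U 0); have y2 := sqr_ge0 (bloch U 1).
have z2 := sqr_ge0 (bloch U 2).
by case: (ord3P k) => [->|[->|->]]; lra.
Qed.

Lemma spin_inj (x y z x' y' z' : R) :
  spin 'i%C x%:C y%:C z%:C = spin 'i%C x'%:C y'%:C z'%:C -> [/\ x = x', y = y' & z = z'].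
Proof.
move=> /matrixP h; move: (h 0 0) (h 0 1); rewrite !mxE /=.
move=> /eqP; rewrite eq_complex /= => /andP[/eqP -> _].
move=> /eqP; rewrite eq_complex /= => /andP[/eqP h1 /eqP h2].
by split=> //; lra.
Qed.

(** Translating [U] by an element of SU(2) thus rotates its Bloch vector, which turns Haar
    invariance into identities between moments. *)
Lemma rotated_szM (V U : 'M[C]_2) :
  rotated_sz (V *m U) = V *m rotated_sz U *m adjmx V.
Proof. by rewrite /rotated_sz adjmxM !mulmxA. Qed.

End Bloch.

(** * First and second moments under the Haar measure *)

Section BlochMoments.
Variable R : realType.
Local Notation C := R[i].
Local Notation T := (@SU2 R).
Local Notation G := (SU2_borel R).

Lemma adjmx_mx22 (a b c d : C) : adjmx (mx22 a b c d) = mx22 a^* c^* b^* d^*.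
Proof. by apply: mx2P; rewrite !mxE. Qed.

Lemma mx22_SU2 (a b c d : C) :
  a * a^* + b * b^* = 1 -> c * c^* + d * d^* = 1 -> a * c^* + b * d^* = 0 ->
  a * d - b * c = 1 -> SU2 (mx22 a b c d).
Proof.
move=> ab cd abcd det1; split; last by rewrite det_mx22.
have cdab : c * a^* + d * b^* = 0.
  rewrite -(conjC0 C) -abcd rmorphD !rmorphM /= !conjCK.
  by rewrite [a^* * c]mulrC [b^* * d]mulrC.
apply/unitarymxP; transitivity (mx22 a b c d *m adjmx (mx22 a b c d)) => //.
by rewrite adjmx_mx22 mul_mx22 ab cd abcd cdab; apply: mx2P; rewrite !mxE.
Qed.

Lemma conj_i : ('i%C : C)^* = - 'i%C.
Proof. by apply/eqP; rewrite eq_complex /= oppr0 !eqxx. Qed.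

Lemma mulii : 'i%C * 'i%C = -1 :> C.
Proof. by rewrite -expr2 sqr_i. Qed.

Lemma half_turn_SU2 : SU2 (mx22 0 'i%C 'i%C 0 : 'M[C]_2).
Proof.
by apply: mx22_SU2; rewrite !(conj_i, conjC0, mul0r, mulr0, addr0, add0r, mulrN, mulii, opprK).
Qed.

Local Notation h := (2^-1%:C : C).

Local Notation cyclic_turn :=
  (mx22 (h * (1 + 'i%C)) (h * (1 + 'i%C)) (h * (-1 + 'i%C)) (h * (1 - 'i%C)) : 'M[C]_2).

Lemma half_mul2 : h * 2 = 1.
Proof. by rewrite -(rmorph_nat (real_complex R)) -rmorphM /= mulVf. Qed.

Lemma conj_cyclic_turn :
  [/\ (h * (1 + 'i%C))^* = h * (1 - 'i%C), (h * (-1 + 'i%C))^* = h * (-1 - 'i%C)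
    & (h * (1 - 'i%C))^* = h * (1 + 'i%C)].
Proof.
by split; rewrite rmorphM rmorphD ?rmorphN ?rmorph1 /= conjC_real conj_i ?opprK.
Qed.

Lemma adjmx_cyclic_turn : adjmx cyclic_turn =
  mx22 (h * (1 - 'i%C)) (h * (-1 - 'i%C)) (h * (1 - 'i%C)) (h * (1 + 'i%C)).
Proof. by have [c1 c2 c3] := conj_cyclic_turn; rewrite adjmx_mx22 c1 c2 c3. Qed.

Lemma cyclic_turn_SU2 : SU2 cyclic_turn.
Proof.
have [c1 c2 c3] := conj_cyclic_turn; have ii := mulii.
have hh4 (t : C) : t = h * h * 4 * t.
  by transitivity ((h * 2) * (h * 2) * t); [rewrite half_mul2 !mul1r|ring].
by apply: mx22_SU2; rewrite ?c1 ?c2 ?c3 [RHS]hh4; ring: ii.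
Qed.

Lemma bloch_continuous k : continuous (fun U : T => bloch (\val U) k).
Proof.
have cM : continuous (fun U : T => rotated_sz (\val U)).
  apply: mulmx_continuous.
    apply: mulmx_continuous; [exact: SU2_val_continuous|exact: cst_continuous].
  move=> U; apply: (@continuous_comp _ _ _ (\val : T -> 'M[C]_2) (@adjmx R 2 2)).
    exact: SU2_val_continuous.
  exact: adjmx_continuous.
have cMij i j : continuous (fun U : T => rotated_sz (\val U) i j).
  move=> U; apply: (@continuous_comp _ _ _ (fun U : T => rotated_sz (\val U)) (fun M => M i j) U (cM U)).
  exact: mx_entry_continuous.
have cRe i j : continuous (fun U : T => complex.Re (rotated_sz (\val U) i j)).
  move=> U; apply: (@continuous_comp _ _ _ _ (@complex.Re R) U (cMij i j U)).
  exact: Re_continuous.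
have cIm i j : continuous (fun U : T => complex.Im (rotated_sz (\val U) i j)).
  move=> U; apply: (@continuous_comp _ _ _ _ (@complex.Im R) U (cMij i j U)).
  exact: Im_continuous.
rewrite /bloch; case: (ord3P k) => [->|[->|->]] /= U; [exact: cRe| |exact: cRe].
exact: (cvgN (cIm 0 1 U)).
Qed.

Variable mu : probability G R.
Hypothesis Hmu : normalized_haar mu.

Local Notation n k := (fun U : G => bloch (\val U) k).
Local Notation E f := (Rintegral mu setT f).

Lemma bloch_half_turn (U : T) :
  let V : T := SigSub (mem_set half_turn_SU2) in
  [/\ bloch (\val (SU2_mulg V U)) 0 = bloch (\val U) 0,
      bloch (\val (SU2_mulg V U)) 1 = - bloch (\val U) 1 &
      bloch (\val (SU2_mulg V U)) 2 = - bloch (\val U) 2].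
Proof.
move=> V; apply: spin_inj; rewrite -rotated_szE; last exact: set_valP.
rewrite rotated_szM rotated_szE; last exact: set_valP.
rewrite adjmx_mx22 !conj_i !conjC0 !rmorphN; apply: spin_half_turn; exact: mulii.
Qed.

Lemma bloch_cyclic_turn (U : T) :
  let V : T := SigSub (mem_set cyclic_turn_SU2) in
  [/\ bloch (\val (SU2_mulg V U)) 0 = bloch (\val U) 1,
      bloch (\val (SU2_mulg V U)) 1 = bloch (\val U) 2 &
      bloch (\val (SU2_mulg V U)) 2 = bloch (\val U) 0].
Proof.
move=> V; apply: spin_inj; rewrite -rotated_szE; last exact: set_valP.
rewrite rotated_szM rotated_szE; last exact: set_valP.
rewrite adjmx_cyclic_turn.
apply: spin_cyclic_turn; [exact: mulii|].
exact: half_mul2.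
Qed.

Lemma bloch_integrable k : mu.-integrable setT (EFin \o n k).
Proof.
apply: (continuous_bounded_integrable mu (@bloch_continuous k) (M := 1)).
by move=> U; apply: bloch_le1; exact: set_valP.
Qed.

Lemma bloch_mul_continuous j k :
  continuous (fun U : T => bloch (\val U) j * bloch (\val U) k).
Proof. move=> U; exact: (cvgM (@bloch_continuous j U) (@bloch_continuous k U)). Qed.

Lemma bloch_mul_le1 j k (U : T) : `|bloch (\val U) j * bloch (\val U) k| <= 1.
Proof. by rewrite normrM mulr_ile1 //; apply: bloch_le1; exact: set_valP. Qed.

Lemma bloch_mul_integrable j k :
  mu.-integrable setT (EFin \o (fun U : G => bloch (\val U) j * bloch (\val U) k)).
Proof.
exact: (continuous_bounded_integrable mu (@bloch_mul_continuous j k) (@bloch_mul_le1 j k)).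
Qed.

(** Invariance makes the integral equal to its own opposite. *)
Lemma Rintegral_odd (V : T) (f : T -> R) :
  continuous f -> (forall U, `|f U| <= 1) ->
  (forall U, f (SU2_mulg V U) = - f U) -> E f = 0.
Proof.
move=> cf f1 fV; have := haar_Rintegral Hmu V cf f1.
have -> : E (fun U : G => f (SU2_mulg V U)) = E (fun U : G => -1 * f U).
  by apply: eq_Rintegral => U _; rewrite fV mulN1r.
rewrite RintegralZl //; last exact: continuous_bounded_integrable cf f1.
by move=> ?; lra.
Qed.

(** The half turn negates component 1, and the cyclic turn carries its mean over to the other
    two. *)
Lemma bloch_mean k : E (n k) = 0.
Proof.
have ib k' : forall U : T, `|bloch (\val U) k'| <= 1.
  by move=> U; apply: bloch_le1; exact: set_valP.
have cyc k' := haar_Rintegral Hmu (SigSub (mem_set cyclic_turn_SU2))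
  (@bloch_continuous k') (ib k').
have n1 : E (n 1) = 0.
  apply: (@Rintegral_odd (SigSub (mem_set half_turn_SU2))); first exact: bloch_continuous.
    exact: ib.
  by move=> U; case: (bloch_half_turn U).
have n0 : E (n 0) = 0.
  rewrite -n1 -(cyc 0); apply: eq_Rintegral => U _; by case: (bloch_cyclic_turn U).
have n2 : E (n 2) = 0.
  rewrite -n0 -(cyc 2); apply: eq_Rintegral => U _; by case: (bloch_cyclic_turn U).
by case: (ord3P k) => [->|[->|->]].
Qed.

(** The product of components 0 and 1 is odd under the half turn; the cyclic turn spreads this to
    all mixed products and makes the three squares equal in mean. *)
Lemma bloch_covariance j k :
  E (fun U => bloch (\val U) j * bloch (\val U) k) = (j == k)%:R / 3.
Proof.
pose m j k := E (fun U => bloch (\val U) j * bloch (\val U) k).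
rewrite -[LHS]/(m j k).
have mC j' k' : m j' k' = m k' j'.
  by apply: eq_Rintegral => U _; rewrite mulrC.
have cyc j' k' := haar_Rintegral Hmu (SigSub (mem_set cyclic_turn_SU2))
  (@bloch_mul_continuous j' k') (@bloch_mul_le1 j' k').
have m01 : m 0 1 = 0.
  apply: (@Rintegral_odd (SigSub (mem_set half_turn_SU2))).
  - exact: bloch_mul_continuous.
  - exact: bloch_mul_le1.
  - by move=> U; case: (bloch_half_turn U) => -> -> _; rewrite mulrN.
have m20 : m 2 0 = 0.
  rewrite -m01 /m -(cyc 2 0); apply: eq_Rintegral => U _.
  by case: (bloch_cyclic_turn U) => -> _ ->.
have m12 : m 1 2 = 0.
  rewrite -m20 /m -(cyc 1 2); apply: eq_Rintegral => U _.
  by case: (bloch_cyclic_turn U) => _ -> ->.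
have m00 : m 0 0 = m 1 1.
  rewrite /m -(cyc 0 0); apply: eq_Rintegral => U _.
  by case: (bloch_cyclic_turn U) => -> _ _.
have m11 : m 1 1 = m 2 2.
  rewrite /m -(cyc 1 1); apply: eq_Rintegral => U _.
  by case: (bloch_cyclic_turn U) => _ -> _.
(* The Bloch vector has length 1 and [mu] has mass 1, which fixes the common value 1/3. *)
have msum : m 0 0 + m 1 1 + m 2 2 = 1.
  pose f k (U : G) := bloch (\val U) k * bloch (\val U) k.
  have fi k' : mu.-integrable setT (EFin \o f k') by exact: bloch_mul_integrable.
  transitivity (E (fun U : G => f 0 U + f 1 U + f 2 U)).
    rewrite RintegralD //; last exact: (integrableD measurableT (fi 0) (fi 1)).
    by rewrite RintegralD.
  transitivity (E (fun=> 1)).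
    apply: eq_Rintegral => U _; rewrite -(@bloch_sqr _ (\val U)) ?expr2 //.
    exact: set_valP.
  rewrite Rintegral_cst // mul1r; exact: (congr1 fine (probability_setT mu)).
case: (ord3P j) => [->|[->|->]]; case: (ord3P k) => [->|[->|->]];
  rewrite ?m01 ?[m 1 0]mC ?m01 ?m12 ?[m 2 1]mC ?m12 ?m20 ?[m 0 2]mC ?m20 /= ?mul0r //; lra.
Qed.

End BlochMoments.

(** * The twirled state *)

Section TwirlOmega.
Variable R : realType.
Local Notation C := R[i].
Local Notation T := (@SU2 R).
Local Notation G := (SU2_borel R).

Definition sigma (k : 'I_3) : 'M[C]_2 :=
  [tuple spin 'i%C 1 0 0; spin 'i%C 0 1 0; spin 'i%C 0 0 1]`_k.

(* The index [ord0] stands for the identity, [lift ord0 k] for [sigma k]. *)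
Definition pauli (a : 'I_4) : 'M[C]_2 :=
  if unlift ord0 a is Some k then sigma k else 1%:M.

Definition pauli_coef (p q : R) (U : 'M[C]_2) (a : 'I_4) : R :=
  if unlift ord0 a is Some k then q * bloch U k else p.

Lemma spin_sigma (x : 'I_3 -> C) :
  spin 'i%C (x 0) (x 1) (x 2) = \sum_k x k *: sigma k.
Proof.
by rewrite sum_ord3 spin_linear.
Qed.

Lemma rotated_diag2 (c s : R) (U : 'M[C]_2) : SU2 U ->
  U *m diag2 c s *m adjmx U
    = \sum_a (pauli_coef ((c + s) / 2) ((c - s) / 2) U a)%:C *: pauli a.
Proof.
move=> hU; set p := (c + s) / 2; set q := (c - s) / 2.
have -> : diag2 c s = p%:C *: 1%:M + q%:C *: (delta_mx 0 0 - delta_mx 1 1).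
  have -> : c = p + q by rewrite /p /q; field.
  have -> : s = p - q by rewrite /p /q; field.
  by rewrite /diag2 rmorphD rmorphB diag_mx22.
rewrite mulmxDr mulmxDl -!scalemxAr -!scalemxAl mulmx1 SU2_mul_adj // -/(rotated_sz U).
rewrite rotated_szE // (spin_sigma (fun k => (bloch U k)%:C)) scaler_sumr.
rewrite [RHS]big_ord_recl /pauli_coef /pauli unlift_none; congr (_ + _).
by apply: eq_bigr => k _; rewrite liftK scalerA -rmorphM.
Qed.

Lemma ket_OmegaE (gamma : R) :
  ket_Omega gamma
    = vecmx (diag2 (cos (pi / 4 - gamma / 2)) (sin (pi / 4 - gamma / 2))).
Proof.
have E (k : 'I_2) : (delta_mx k 0 : 'cV[C]_2) *t (delta_mx k 0 : 'cV[C]_2)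
    = vecmx (delta_mx k k : 'M[C]_2).
  apply/matrixP => i j; rewrite !mxE !ord1 !eqxx !andbT.
  by case: eqP; case: eqP; rewrite /= ?mulr1 ?mulr0.
rewrite /ket_Omega /ket_up /ket_down !E.
by apply/matrixP => i j; rewrite !mxE.
Qed.

Lemma twirl_conj_Omega (gamma : R) (U : 'M[C]_2) :
  let c := cos (pi / 4 - gamma / 2) in let s := sin (pi / 4 - gamma / 2) in
  twirl_conj U (Omega gamma) = proj_on (vecmx (U *m diag2 c s *m adjmx U)).
Proof.
move=> c s; have KE : (U *t conjmx_entry U) *m vecmx (diag2 c s)
    = vecmx (U *m diag2 c s *m adjmx U).
  by rewrite mul_tensmx_vecmx /adjmx /conjmx_entry map_trmx.
by rewrite /twirl_conj /Omega ket_OmegaE -/c -/s -KE /proj_on adjmxM !mulmxA.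
Qed.

Variable mu : probability G R.
Hypothesis Hmu : normalized_haar mu.
Local Notation E f := (Rintegral mu setT f).

Lemma pauli_coef_moment (p q : R) (a b : 'I_4) :
  let f (U : G) := pauli_coef p q (\val U) a * pauli_coef p q (\val U) b in
  mu.-integrable setT (EFin \o f) /\
  E f = (a == b)%:R * (if a == ord0 then p ^+ 2 else q ^+ 2 / 3).
Proof.
(* In every case the product is a constant times one of: two Bloch components, one component, or
   1. *)
have scal (g : G -> R) (r x : R) (f : G -> R) : mu.-integrable setT (EFin \o g) ->
    E g = x -> (forall U, f U = r * g U) ->
    mu.-integrable setT (EFin \o f) /\ E f = r * x.
  move=> gi <- fg; have -> : f = (fun U => r * g U) by apply/funext.
  by split; [exact: (integrableZl measurableT r gi)|rewrite RintegralZl].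
have one : mu.-integrable setT (EFin \o (fun=> 1 : R) : G -> \bar R).
  apply: (continuous_bounded_integrable mu (f := fun=> 1) (M := 1)); first exact: cst_continuous.
  by move=> _; rewrite normr1.
have E1 : E (fun=> 1) = 1.
  by rewrite Rintegral_cst // mul1r; exact: (congr1 fine (probability_setT mu)).
move=> f; rewrite /f /pauli_coef.
case: (unliftP ord0 a) => [j ->|->]; case: (unliftP ord0 b) => [k ->|->].
- rewrite (inj_eq lift_inj) /=.
  have [fi ->] := scal _ (q ^+ 2) _
    (fun U : G => q * bloch (\val U) j * (q * bloch (\val U) k))
    (bloch_mul_integrable mu j k) (bloch_covariance Hmu j k)
    (fun U => ltac:(cbv beta; ring)).
  by split=> //; rewrite mulrCA mulrA.
- have [fi ->] := scal _ (q * p) _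
    (fun U : G => q * bloch (\val U) j * p)
    (bloch_integrable mu j) (bloch_mean Hmu j)
    (fun U => ltac:(cbv beta; ring)).
  by split=> //; rewrite mulr0 mul0r.
- have [fi ->] := scal _ (q * p) _
    (fun U : G => p * (q * bloch (\val U) k))
    (bloch_integrable mu k) (bloch_mean Hmu k)
    (fun U => ltac:(cbv beta; ring)).
  by split=> //; rewrite mulr0 mul0r.
- have [fi ->] := scal _ (p ^+ 2) _ (fun U : G => p * p) one E1 (fun U => ltac:(cbv beta; ring)).
  by split=> //; rewrite mulr1 eqxx mul1r.
Qed.

(** [twirl] integrates real and imaginary parts separately; linearity with real integrands and
    complex coefficients reassembles them. *)
Lemma complex_Rintegral_sum (I : finType) (f : I -> G -> R) (c : I -> C)
    (F : G -> C) :
  (forall i, mu.-integrable setT (EFin \o f i)) ->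
  (forall U, F U = \sum_i (f i U)%:C * c i) ->
  (E (fun U => complex.Re (F U)) +i* E (fun U => complex.Im (F U)))%C
    = \sum_i (E (f i))%:C * c i.
Proof.
move=> fi FE.
have lin (r : I -> R) : E (fun U => \sum_i f i U * r i) = \sum_i E (f i) * r i.
  (* Integrability of the partial sums is carried through the induction, since additivity of the
     integral asks for it. *)
  suff : mu.-integrable setT (EFin \o (fun U => \sum_i f i U * r i)) /\
      E (fun U => \sum_i f i U * r i) = \sum_i E (f i) * r i by case.
  elim: (index_enum I) => [|i s [IHi IHE]].
    under [X in EFin \o X]eq_fun do rewrite big_nil.
    under eq_Rintegral do rewrite big_nil.
    rewrite big_nil Rintegral_cst // mul0r; split=> //; exact: integrable0.
  have Zi : mu.-integrable setT (EFin \o (fun U => f i U * r i)).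
    exact: (integrableZr measurableT (r i) (fi i)).
  under [X in EFin \o X]eq_fun do rewrite big_cons.
  under eq_Rintegral do rewrite big_cons.
  rewrite big_cons RintegralD // RintegralZr // IHE; split=> //.
  exact: (integrableD measurableT Zi IHi).
have ReE U : complex.Re (F U) = \sum_i f i U * complex.Re (c i).
  rewrite FE raddf_sum; apply: eq_bigr => i _.
  by case: (c i) => x y /=; rewrite mul0r subr0.
have ImE U : complex.Im (F U) = \sum_i f i U * complex.Im (c i).
  rewrite FE raddf_sum; apply: eq_bigr => i _.
  by case: (c i) => x y /=; rewrite mul0r addr0.
under eq_Rintegral do rewrite ReE.
under [X in (_ +i* X)%C]eq_Rintegral do rewrite ImE.
rewrite !lin; apply/eqP; rewrite eq_complex; apply/andP; split=> /=; apply/eqP.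
- rewrite raddf_sum; apply: eq_bigr => i _.
  by case: (c i) => x y /=; rewrite mul0r subr0.
- rewrite raddf_sum; apply: eq_bigr => i _.
  by case: (c i) => x y /=; rewrite mul0r addr0.
Qed.

Lemma adjmx_spin (x y z : R) :
  adjmx (spin 'i%C x%:C y%:C z%:C) = spin 'i%C x%:C y%:C z%:C :> 'M[C]_2.
Proof.
rewrite adjmx_mx22 rmorphD rmorphB rmorphM rmorphN /= conj_i !conjC_real.
by rewrite mulNr opprK.
Qed.

Lemma adjmx_sigma k : adjmx (sigma k) = sigma k.
Proof. by rewrite /sigma; case: (ord3P k) => [->|[->|->]]; exact: adjmx_spin. Qed.

Lemma sum_pauli (I J : 'I_(2 * 2)) :
  \sum_a vecmx (pauli a) I 0 * (vecmx (pauli a) J 0)^* = (I == J)%:R * 2.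
Proof.
case: (mxtens_indexP I) => i1 i2; case: (mxtens_indexP J) => j1 j2.
rewrite (can_eq (@mxtens_indexK _ _)) xpair_eqE.
have ad a : adjmx (pauli a) = pauli a.
  by rewrite /pauli; case: unlift => [k|]; rewrite ?adjmx_sigma ?adjmx1.
have term a : vecmx (pauli a) (mxtens_index (i1, i2)) 0
    * (vecmx (pauli a) (mxtens_index (j1, j2)) 0)^* = pauli a i1 i2 * pauli a j2 j1.
  by rewrite -{4}(ad a) !mxE !mxtens_indexK.
under eq_bigr do rewrite term.
rewrite -(@fierz _ 'i%C) ?mulii // big_ord_recl sum_ord3 /pauli unlift_none !liftK.
by rewrite !addrA.
Qed.

Lemma twirl_Omega (gamma : R) :
  let c := cos (pi / 4 - gamma / 2) in let s := sin (pi / 4 - gamma / 2) in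
  let w := ((c - s) / 2) ^+ 2 / 3 in
  twirl mu (Omega gamma) = (2 * w)%:C%:M
    + (((c + s) / 2) ^+ 2 - w)%:C *: proj_on (vecmx (diag2 1 1)).
Proof.
move=> c s w; set p := (c + s) / 2; set q := (c - s) / 2.
apply/matrixP => I J.
pose t (ab : 'I_4 * 'I_4) (U : G) :=
  pauli_coef p q (\val U) ab.1 * pauli_coef p q (\val U) ab.2.
pose k (ab : 'I_4 * 'I_4) := vecmx (pauli ab.1) I 0 * (vecmx (pauli ab.2) J 0)^*.
rewrite mxE (@complex_Rintegral_sum _ t k); first last.
- move=> U; rewrite twirl_conj_Omega proj_onE rotated_diag2; last exact: set_valP.
  rewrite -/p -/q.
  have vE K : vecmx (\sum_a (pauli_coef p q (\val U) a)%:C *: pauli a) K 0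
      = \sum_a (pauli_coef p q (\val U) a)%:C * vecmx (pauli a) K 0.
    by rewrite mxE summxE; apply: eq_bigr => a _; rewrite !mxE.
  rewrite !vE rmorph_sum big_distrlr pair_big /=; apply: eq_bigr => -[a b] _ /=.
  by rewrite rmorphM /= conjC_real rmorphM mulrACA.
- by move=> [a b]; case: (pauli_coef_moment p q a b).
transitivity (\sum_a \sum_b (E (t (a, b)))%:C * k (a, b)).
  by rewrite pair_big; apply: eq_bigr => -[].
(* The mixed moments vanish, so only the diagonal of the double sum remains. *)
transitivity (\sum_a (if a == ord0 then p ^+ 2 else w)%:C * k (a, a)).
  apply: eq_bigr => a _; rewrite (bigD1 a) //= big1 ?addr0; last first.
    move=> b /negPf ba; have [_ ->] := pauli_coef_moment p q a b.
    by rewrite eq_sym ba mul0r rmorph0 mul0r.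
  by have [_ ->] := pauli_coef_moment p q a a; rewrite eqxx mul1r.
(* Completeness, solved for the sum over the three sigma_k, expresses it through the identity and
   the projection on [vecmx] of 1. *)
have := sum_pauli I J; rewrite big_ord_recl => /(canRL (addKr _)) h.
rewrite big_ord_recl /k /= -mulr_sumr h.
have -> : pauli ord0 = diag2 1 1.
  rewrite /pauli unlift_none /diag2 !scale1r.
  by apply: mx2P; rewrite !mxE /= ?addr0 ?add0r.
rewrite -proj_onE [RHS]mxE [(_%:M) _ _]mxE [X in _ = _ + X]mxE.
set v := proj_on _ I J.
rewrite rmorphB !rmorphM /= rmorph_nat; case: eqP => _; rewrite ?mulr1n ?mulr0n; ring.
Qed.

End TwirlOmega.

Theorem lemma3 (R : realType) (mu : probability (SU2_borel R) R)
    (Hmu : normalized_haar mu) (gamma : R)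
    (gamma_ge0 : 0 <= gamma) (gamma_le : gamma <= pi / 2) :
  entanglement_of_formation (twirl mu (Omega gamma))
    = entanglement_of_formation (Omega gamma)
  /\ geometric_discord (twirl mu (Omega gamma))
    >= geometric_discord (Omega gamma).
Proof.
rewrite (twirl_Omega Hmu) /Omega ket_OmegaE.
set t := pi / 4 - gamma / 2; set c := cos t; set s := sin t.
have pi0 := pi_gt0 R.
(* The angle [t] lies between 0 and [pi / 4]. *)
have c0 : 0 <= c by apply: cos_ge0_pihalf; rewrite /t; apply/andP; split; lra.
have s0 : 0 <= s by apply: sin_ge0_pi; rewrite /t; apply/andP; split; lra.
have cs1 : c ^+ 2 + s ^+ 2 = 1 by exact: cos2Dsin2.
have cs0 : 0 <= c * s by exact: mulr_ge0.
set w := ((c - s) / 2) ^+ 2 / 3; set y := ((c + s) / 2) ^+ 2 - w.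
have w0 : 0 <= w by rewrite divr_ge0 // sqr_ge0.
(* By [cs1], both [w] and [y] are affine in [c * s], which leaves linear arithmetic. *)
have wE : w = (1 - 2 * (c * s)) / 12.
  have -> : 1 - 2 * (c * s) = (c - s) ^+ 2 by rewrite -[X in X - _]cs1; ring.
  by rewrite /w; field.
have yE : y = (1 + 4 * (c * s)) / 6.
  have pE : ((c + s) / 2) ^+ 2 = (1 + 2 * (c * s)) / 4.
    have -> : 1 + 2 * (c * s) = (c + s) ^+ 2 by rewrite -[X in X + _]cs1; ring.
    by field.
  by rewrite /y wE pE; field.
have y0 : 0 <= y by rewrite yE; lra.
split.
  rewrite /entanglement_of_formation concurrence_diag2 // concurrence_isotropic //; last lra.
  (* The twirled state stays on the entangled side: [2 * y - 4 * w] equals [2 * c * s], which is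
     nonnegative. *)
  rewrite max_r; last by rewrite yE wE; lra.
  by rewrite (_ : 2 * y - 2 * (2 * w) = 2 * c * s) //; rewrite yE wE; field.
apply: le_trans (geometric_discord_diag2_le c s) _.
apply: le_trans (geometric_discord_isotropic_ge (2 * w) y).
rewrite ler_pM2l // ler_pXn2r // ?nnegrE // yE.
(* Nonnegativity of [w] says [2 * (c * s) <= 1], which is the remaining inequality [c * s <= y]. *)
by have := w0; rewrite wE; lra.
Qed.
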